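(* Let $H$ be the Hilbert space of (classes of) random variables with finite second moments on a probability space, let $\xi=(\xi_t)_{t\in\mathbb R}$ be a process in $H$ with stationary noncorrelated increments, $\xi_0=0$, let $U\in\mathcal I(\xi)$ and let $W=(W_t)_{t\in\mathbb R}$ be a Markovian $U$-cocycle in $H$. Then $$\xi'_t=W_t\xi_t,\ t\le0,\qquad \xi'_t=\xi_t,\ t>0,$$ is a process with noncorrelated increments.
   Context: The inner product in $H$ is $(\xi,\eta)=\mathbb E(\xi\overline\eta)$; processes are norm-continuous curves in $H$. $\mathcal I(\xi)$ is the set of strongly continuous one-parameter unitary groups $U$ in $H$ with $\xi_{t+s}=\xi_t+U_t\xi_s$ for all $s,t\in\mathbb R$. Increments of $\xi$ are noncorrelated if $\xi_{t_1}-\xi_{s_1}\perp\xi_{t_2}-\xi_{s_2}$ whenever $(s_1,t_1)\cap(s_2,t_2)=\emptyset$. $H^\xi_{[t}$ is the closed span of the increments $\xi_s-\xi_r$ with $s,r\ge t$. A Markovian $U$-cocycle is a strongly continuous family of unitaries $W=(W_t)_{t\in\mathbb R}$ in $H$ with $W_0=I$, $W_{t+s}=W_tU_tW_sU_t^*$ for $s,t\in\mathbb R$, and $W_tf=f$ for $f\in H^\xi_{[t}$, $t>0$. *)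

(* Defs.v *)
From HB Require Import structures.
From mathcomp Require Import all_boot all_order all_algebra.
From mathcomp Require Import generic_quotient ring_quotient sesquilinear.
From mathcomp Require Import complex.
From mathcomp Require Import all_classical all_reals all_analysis measurable_realfun.

Set Implicit Arguments.
Unset Strict Implicit.
Unset Printing Implicit Defensive.
Import Order.TTheory GRing.Theory Num.Theory.
Import numFieldNormedType.Exports.

Local Open Scope classical_set_scope.
Local Open Scope ring_scope.

Section SecondOrder.
Context d (T : measurableType d) (R : realType) (P : probability T R).
Local Notation C := R[i].

(* Mathcomp has no measurable structure on R[i]: a complex random variable is
   a function with measurable real and imaginary parts. *)
Definition finite_second_moment (f : T -> C) : Prop :=
  [/\ measurable_fun [set: T] (fun w => complex.Re (f w)),
      measurable_fun [set: T] (fun w => complex.Im (f w)) &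
      (\int[P]_w ((Normc.normc (f w)) ^+ 2)%:E < +oo)%E].

Let normc2 (z : C) :
  Normc.normc z ^+ 2 = complex.Re z ^+ 2 + complex.Im z ^+ 2.
Proof. by case: z => a b /=; rewrite sqr_sqrtr// addr_ge0 ?sqr_ge0. Qed.

Let Lfun2P (u : T -> R) : measurable_fun setT u ->
  (\int[P]_w (u w ^+ 2)%:E < +oo)%E -> u \in Lfun P 2%:E.
Proof.
move=> mu iu; rewrite inE; apply/andP; split; rewrite inE//=.
rewrite /finite_norm unlock /Lnorm poweR_lty//.
apply: le_lt_trans iu; rewrite le_eqVlt; apply/orP; left; apply/eqP.
apply: eq_integral => w _ /=.
by rewrite (powR_mulrn 2 (normr_ge0 _)) real_normK// num_real.
Qed.

Lemma finite_second_momentP (f : T -> C) : finite_second_moment f <->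
  (fun w => complex.Re (f w)) \in Lfun P 2%:E /\
  (fun w => complex.Im (f w)) \in Lfun P 2%:E.
Proof.
have msq (u : T -> R) : measurable_fun setT u ->
    measurable_fun setT (fun w => (u w ^+ 2)%:E : \bar R).
  by move=> mu; apply/measurable_EFinP; exact: measurable_funX.
split=> [[mR mI fi]|[fR fI]].
  by split; apply: Lfun2P => //; apply: le_lt_trans fi;
    (apply: ge0_le_integral => //=;
      [by move=> *; rewrite lee_fin sqr_ge0
      |exact: msq
      |under eq_fun do rewrite normc2 EFinD; apply: emeasurable_funD; exact: msq
      |move=> w _; rewrite lee_fin normc2 ?lerDl ?lerDr sqr_ge0]).
have m (u : T -> R) : u \in Lfun P 2%:E -> measurable_fun setT u.
  by rewrite inE => /andP[/[!inE]].
split; [exact: m|exact: m|].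
under eq_integral do rewrite normc2 EFinD.
rewrite integralD//=.
- by rewrite lte_add_pinfty// integrable_lty//; exact: Lfun2_integrable_sqr.
- exact: Lfun2_integrable_sqr fR.
- exact: Lfun2_integrable_sqr fI.
Qed.

Let LfunD (r : R) (u v : T -> R) : 1 <= r ->
  u \in Lfun P r%:E -> v \in Lfun P r%:E -> (fun w => u w + v w) \in Lfun P r%:E.
Proof. by rewrite -lee_fin => r1; exact: (Lfun_addr_closed P r1).2. Qed.

Let LfunZ (r a : R) (u : T -> R) : 1 <= r ->
  u \in Lfun P r%:E -> (fun w => a * u w) \in Lfun P r%:E.
Proof.
move=> r1 ur; have -> : (fun w => a * u w) = a \o* u.
  by apply/funext => w /=; rewrite mulrC.
exact: Lfun_scale.
Qed.

Let Lfun_lin (r a b : R) (u v : T -> R) : 1 <= r ->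
  u \in Lfun P r%:E -> v \in Lfun P r%:E ->
  (fun w => a * u w + b * v w) \in Lfun P r%:E.
Proof. by move=> r1 ur vr; apply: LfunD => //; exact: LfunZ. Qed.

Let le12 : 1 <= 2 :> R. Proof. by rewrite ler1n. Qed.

Definition second_order : {pred T -> C} := [pred f | `[< finite_second_moment f >]].

Lemma second_order_submod_closed : submod_closed second_order.
Proof.
split.
  by apply/asboolP/finite_second_momentP; split;
    exact: (Lfun_addr_closed P (lee1n 2)).1.
move=> a f g /asboolP/finite_second_momentP[fR fI].
move=> /asboolP/finite_second_momentP[gR gI].
apply/asboolP/finite_second_momentP; split.
- have -> : (fun w => complex.Re ((a *: f + g) w)) = (fun w =>
      complex.Re a * complex.Re (f w) + - complex.Im a * complex.Im (f w)
      + complex.Re (g w)).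
    apply/funext => w; rewrite -[(a *: f + g) w]/(a * f w + g w) mulNr.
    by case: a (f w) (g w) => [? ?] [? ?] [? ?].
  by apply: LfunD => //; exact: Lfun_lin.
- have -> : (fun w => complex.Im ((a *: f + g) w)) = (fun w =>
      complex.Re a * complex.Im (f w) + complex.Im a * complex.Re (f w)
      + complex.Im (g w)).
    apply/funext => w; rewrite -[(a *: f + g) w]/(a * f w + g w).
    by case: a (f w) (g w) => [? ?] [? ?] [? ?].
  by apply: LfunD => //; exact: Lfun_lin.
Qed.

HB.instance Definition _ := GRing.isSubmodClosed.Build C (T -> C) second_order
  second_order_submod_closed.

Record rv2 := Rv2 { rv2_fun :> T -> C ; _ : rv2_fun \in second_order }.
HB.instance Definition _ := [isSub for rv2_fun].
HB.instance Definition _ := [Choice of rv2 by <:].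
HB.instance Definition _ := [SubChoice_isSubLmodule of rv2 by <:].

Definition null_rv : {pred rv2} := 
  [pred f : rv2 | `[< {ae P, forall w, f w = 0} >]].

Lemma null_rv_zmod_closed : zmod_closed null_rv.
Proof.
split.
  by apply/asboolP; exact: filterE.
move=> f g /asboolP f0 /asboolP g0; apply/asboolP.
apply: filterS2 f0 g0 => w f0 g0.
by rewrite -[(f - g) w]/(f w - g w) f0 g0 subrr.
Qed.

HB.instance Definition _ := GRing.isZmodClosed.Build rv2 null_rv
  null_rv_zmod_closed.

(* The Hilbert space H: second-order complex random variables modulo almost
   sure equality (see class_of_rvP). *)
Definition L2 : Type := Quotient.quot null_rv.
HB.instance Definition _ := Choice.on L2.
HB.instance Definition _ := GRing.Zmodule.on L2.
HB.instance Definition _ := EqQuotient.on L2.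
HB.instance Definition _ := ZmodQuotient.on L2.

Local Open Scope quotient_scope.

Definition class_of_rv (f : rv2) : L2 := \pi_L2 f.

Lemma class_of_rvP (f g : rv2) :
  class_of_rv f = class_of_rv g <-> {ae P, forall w, f w = g w}.
Proof.
rewrite /class_of_rv; split.
  move=> /eqP; rewrite -Quotient.idealrBE => /asboolP.
  by apply: filterS => w /eqP; rewrite -[(f - g) w]/(f w - g w) subr_eq0 => /eqP.
move=> fg; apply/eqP; rewrite -Quotient.idealrBE; apply/asboolP.
by apply: filterS fg => w fg; rewrite -[(f - g) w]/(f w - g w) fg subrr.
Qed.

Definition rv_of_class (x : L2) : rv2 := repr x.

Lemma rv_of_classK : cancel rv_of_class class_of_rv.
Proof. exact: reprK. Qed.

Lemma class_of_rvK (f : rv2) :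
  {ae P, forall w, rv_of_class (class_of_rv f) w = f w}.
Proof. by apply/class_of_rvP; rewrite rv_of_classK. Qed.


Let class_of_rvD (f g : rv2) :
  class_of_rv (f + g) = class_of_rv f + class_of_rv g.
Proof. by rewrite /class_of_rv piE. Qed.

Definition scale_L2 (a : C) (x : L2) : L2 := class_of_rv (a *: rv_of_class x).

Lemma class_of_rvZ (a : C) (f : rv2) :
  class_of_rv (a *: f) = scale_L2 a (class_of_rv f).
Proof.
apply/class_of_rvP; have := class_of_rvK f; apply: filterS => w fw.
by rewrite -[RHS]/(a * rv_of_class (class_of_rv f) w) fw.
Qed.

Let scale_L2A a b x : scale_L2 a (scale_L2 b x) = scale_L2 (a * b) x.
Proof. by rewrite -(rv_of_classK x) -!class_of_rvZ scalerA. Qed.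

Let scale_L21 : left_id 1 scale_L2.
Proof. by move=> x; rewrite -(rv_of_classK x) -!class_of_rvZ scale1r. Qed.

Let scale_L2Dr : right_distributive scale_L2 +%R.
Proof.
move=> a x y; rewrite -(rv_of_classK x) -(rv_of_classK y).
by rewrite -class_of_rvD -!class_of_rvZ scalerDr class_of_rvD.
Qed.

Let scale_L2Dl x : {morph scale_L2^~ x : a b / a + b}.
Proof.
move=> a b; rewrite -(rv_of_classK x).
by rewrite -!class_of_rvZ scalerDl class_of_rvD.
Qed.

HB.instance Definition _ := GRing.Zmodule_isLmodule.Build C L2
  scale_L2A scale_L21 scale_L2Dr scale_L2Dl.

(* Componentwise expectation; meaningful when both components are integrable. *)
Definition expectation_C (f : T -> C) : C :=
  Complex (fine 'E_P[fun w => complex.Re (f w)])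
          (fine 'E_P[fun w => complex.Im (f w)]).

(* The inner product (xi, eta) = E (xi conj eta), computed on representatives; it
   does not depend on their choice (see inner_class_of_rv). *)
Definition inner (x y : L2) : C :=
  expectation_C (fun w => rv_of_class x w * (rv_of_class y w)^*).

Let integrable_C (f : T -> C) :=
  (fun w => complex.Re (f w)) \in Lfun P 1 /\
  (fun w => complex.Im (f w)) \in Lfun P 1.

Let rv2P (f : rv2) : finite_second_moment f.
Proof. by case: f => f /= /asboolP. Qed.

Let integrable_C_mul (f g : rv2) : integrable_C (fun w => f w * (g w)^*).
Proof.
have /finite_second_momentP[fR fI] := rv2P f.
have /finite_second_momentP[gR gI] := rv2P g.
split.
- have -> : (fun w => complex.Re (f w * (g w)^*)) = (fun w =>
      1 * (complex.Re (f w) * complex.Re (g w))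
      + 1 * (complex.Im (f w) * complex.Im (g w))).
    apply/funext => w; rewrite !mul1r.
    by case: (f w) (g w) => [? ?] [? ?] /=; rewrite mulrN opprK.
  by apply: Lfun_lin => //; exact: Lfun2_mul_Lfun1.
- have -> : (fun w => complex.Im (f w * (g w)^*)) = (fun w =>
      1 * (complex.Im (f w) * complex.Re (g w))
      + -1 * (complex.Re (f w) * complex.Im (g w))).
    apply/funext => w; rewrite mul1r mulN1r.
    by case: (f w) (g w) => [? ?] [? ?] /=; rewrite mulrN addrC.
  by apply: Lfun_lin => //; exact: Lfun2_mul_Lfun1.
Qed.

Let fine_expD (a b : R) (u v : T -> R) : u \in Lfun P 1 -> v \in Lfun P 1 ->
  fine 'E_P[fun w => a * u w + b * v w] =
  a * fine 'E_P[u] + b * fine 'E_P[v].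
Proof.
move=> u1 v1; rewrite unlock.
rewrite -[LHS]/(Rintegral P setT (fun w => a * u w + b * v w)).
rewrite RintegralD//; last 2 first.
- exact/Lfun1_integrable/LfunZ.
- exact/Lfun1_integrable/LfunZ.
by rewrite !RintegralZl//; exact/Lfun1_integrable.
Qed.

Let expectation_C_linear (a : C) (f g : T -> C) :
  integrable_C f -> integrable_C g ->
  expectation_C (fun w => a * f w + g w) =
  a * expectation_C f + expectation_C g.
Proof.
move=> [fR fI] [gR gI]; rewrite /expectation_C.
case: a => a b.
have -> : (fun w => complex.Re (Complex a b * f w + g w)) = (fun w =>
    1 * (a * complex.Re (f w) + - b * complex.Im (f w))
    + 1 * complex.Re (g w)).
  apply/funext => w; rewrite !mul1r mulNr.
  by case: (f w) (g w) => [? ?] [? ?].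
have -> : (fun w => complex.Im (Complex a b * f w + g w)) = (fun w =>
    1 * (a * complex.Im (f w) + b * complex.Re (f w))
    + 1 * complex.Im (g w)).
  apply/funext => w; rewrite !mul1r.
  by case: (f w) (g w) => [? ?] [? ?].
rewrite !fine_expD//; [|exact: Lfun_lin|exact: Lfun_lin].
by rewrite !mul1r mulNr.
Qed.

Let expectation_C_ae (f g : T -> C) : integrable_C f -> integrable_C g ->
  {ae P, forall w, f w = g w} -> expectation_C f = expectation_C g.
Proof.
have m (u : T -> R) : u \in Lfun P 1 -> measurable_fun setT (EFin \o u).
  by move=> /Lfun1_integrable/measurable_int.
move=> [fR fI] [gR gI] fg; rewrite /expectation_C unlock.
by congr Complex; congr fine; apply: ae_eq_integral;
  rewrite ?(m _ fR) ?(m _ fI) ?(m _ gR) ?(m _ gI)//;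
  (try exact: m); apply: filterS fg => w -> _.
Qed.

Lemma inner_class_of_rv (f g : rv2) :
  inner (class_of_rv f) (class_of_rv g) =
  expectation_C (fun w => f w * (g w)^*).
Proof.
apply: expectation_C_ae; [exact: integrable_C_mul|exact: integrable_C_mul|].
by apply: filterS2 (class_of_rvK f) (class_of_rvK g) => w -> ->.
Qed.

Let expectation_C_conj (f : T -> C) : integrable_C f ->
  expectation_C (fun w => (f w)^*) = (expectation_C f)^*.
Proof.
move=> [_ fI]; rewrite /expectation_C -[RHS]/(Complex _ (- _)).
congr Complex; first by congr fine; congr expectation; apply/funext => w;
  case: (f w).
have -> : (fun w => complex.Im (f w)^*) =
    (fun w => -1 * complex.Im (f w) + 0 * complex.Im (f w)).
  by apply/funext => w; rewrite mul0r addr0 mulN1r; case: (f w).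
by rewrite fine_expD// mulN1r mul0r addr0.
Qed.

Let innerC x y : inner x y = (-1) ^+ false * (inner y x)^*.
Proof.
rewrite expr0 mul1r /inner -expectation_C_conj; last exact: integrable_C_mul.
by congr expectation_C; apply/funext => w; rewrite rmorphM/= conjCK mulrC.
Qed.

Let inner_linearl (z : L2) : GRing.linear_for *%R (inner^~ z).
Proof.
move=> a x y; rewrite -(rv_of_classK x) -(rv_of_classK y) -(rv_of_classK z).
rewrite -[a *: _]/(scale_L2 a _) -class_of_rvZ -class_of_rvD.
rewrite !inner_class_of_rv -expectation_C_linear; last 2 first.
- exact: integrable_C_mul.
- exact: integrable_C_mul.
congr expectation_C; apply/funext => w.
by rewrite [(_ + _ : rv2) w]/(a * _ + _) mulrDl mulrA.
Qed.

Let inner_linearr (z : L2) : GRing.linear_for (Num.conj \; *%R) (inner z).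
Proof.
move=> a x y; rewrite innerC inner_linearl (innerC z x) (innerC z y).
by rewrite !expr0 !mul1r rmorphD/= rmorphM.
Qed.

HB.instance Definition _ := bilinear_isBilinear.Build C L2 L2 C
  *%R (Num.conj \; *%R) inner (inner_linearl, inner_linearr).

HB.instance Definition _ := isHermitianSesquilinear.Build C L2 false Num.conj
  inner innerC.

Let inner_gt0 (x : L2) : x != 0 -> 0 < inner x x.
Proof.
pose f := rv_of_class x; move=> x0.
have -> : inner x x =
    Complex (fine 'E_P[fun w => Normc.normc (f w) ^+ 2]) 0.
  rewrite /inner /expectation_C; congr Complex.
    congr fine; congr expectation; apply/funext => w.
    by rewrite normc2 -/f; case: (f w) => a b /=; rewrite mulrN opprK -!expr2.
  rewrite (_ : (fun w => _) = cst 0) ?expectation_cst//.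
  apply/funext => w; rewrite -/f; case: (f w) => a b /=.
  by rewrite mulrN mulrC addNr.
rewrite ltcE/= eqxx/= unlock.
have [mR mI fi] := rv2P f.
have i0 : (0 <= \int[P]_w (Normc.normc (f w) ^+ 2)%:E)%E.
  by apply: integral_ge0 => w _; rewrite lee_fin sqr_ge0.
rewrite fine_gt0// fi andbT lt_neqAle i0 andbT eq_sym.
apply: contra_neq x0 => f0; rewrite -(rv_of_classK x) -/f.
have -> : (0 : L2) = class_of_rv 0 by rewrite /class_of_rv piE.
apply/class_of_rvP.
have /ae_eq_integral_abs : measurable_fun setT
    (fun w => (Normc.normc (f w) ^+ 2)%:E : \bar R).
  apply/measurable_EFinP; under eq_fun do rewrite normc2.
  by apply: measurable_funD; exact: measurable_funX.
move=> /(_ P measurableT)[+ _].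
under eq_integral do rewrite gee0_abs ?lee_fin ?sqr_ge0//.
move=> /(_ f0); apply: filterS => w /(_ I)[] /eqP.
by rewrite sqrf_eq0 => /eqP/Normc.eq0_normc.
Qed.

HB.instance Definition _ := isDotProduct.Build C L2 inner inner_gt0.

Definition norm_L2 (x : L2) : C := sqrtC (inner x x).

Let inner_CauchySchwarz (x y : L2) :
  `|inner x y| ^+ 2 <= inner x x * inner y y.
Proof.
have [->|y0] := eqVneq y 0; first by rewrite !linear0r/= normr0 expr0n/=.
pose a := inner x y / inner y y; pose u := x - a *: y.
have uy : inner u y = 0.
  by rewrite linearBl/= linearZl_LR/= divfK ?dnorm_eq0// subrr.
have -> : x = u + a *: y by rewrite subrK.
rewrite linearDl/= uy add0r linearZl_LR/= normrM (ger0_norm (dnorm_ge0 _ _)).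
rewrite exprMn expr2 mulrA ler_wpM2r ?dnorm_ge0// -dnormZ.
rewrite hnormDd/=; last by rewrite linearZr_LR/= uy mulr0.
by rewrite lerDr dnorm_ge0.
Qed.

Let norm_L2D (x y : L2) : norm_L2 (x + y) <= norm_L2 x + norm_L2 y.
Proof.
have n0 z : 0 <= norm_L2 z by exact: sqrt_dnorm_ge0.
rewrite -ler_sqr ?nnegrE ?addr_ge0// sqrrD !sqrtCK dnormD [leRHS]addrAC lerD2l.
rewrite -[_ + _](divfK (negbT (pnatr_eq0 C 2))) mulr_natr lerMn2r/=.
rewrite -ReE (le_trans (leif_Re_Creal _))//.
rewrite -ler_sqr ?nnegrE ?mulr_ge0// exprMn !sqrtCK.
exact: inner_CauchySchwarz.
Qed.

Let norm_L2Z (a : C) (x : L2) : norm_L2 (a *: x) = `|a| * norm_L2 x.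
Proof.
rewrite /norm_L2 dnormZ sqrtCM ?nnegrE ?exprn_ge0 ?dnorm_ge0//.
by rewrite sqrCK.
Qed.

Let norm_L2_eq0 (x : L2) : norm_L2 x = 0 -> x = 0.
Proof. by move=> /eqP; rewrite sqrt_dnorm_eq0 => /eqP. Qed.

HB.instance Definition _ := Lmodule_isNormed.Build C L2
  norm_L2D norm_L2Z norm_L2_eq0.

End SecondOrder.

Section Processes.
Context d (T : measurableType d) (R : realType) (P : probability T R).
Local Notation C := R[i].
Local Notation H := (L2 P).

Definition process (xi : R -> H) : Prop := continuous xi.

(* Stationarity in the wide sense: the inner products of increments are
   invariant under time shifts. *)
Definition stationary_increments (xi : R -> H) : Prop :=
  forall r s1 t1 s2 t2 : R,
    inner (xi (t1 + r) - xi (s1 + r)) (xi (t2 + r) - xi (s2 + r)) =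
    inner (xi t1 - xi s1) (xi t2 - xi s2).

(* Without s <= t the intervals would be empty and the condition would make all
   increments pairwise orthogonal, hence zero. *)
Definition noncorrelated_increments (xi : R -> H) : Prop :=
  forall s1 t1 s2 t2 : R, s1 <= t1 -> s2 <= t2 ->
    `]s1, t1[%classic `&` `]s2, t2[%classic = set0 ->
    inner (xi t1 - xi s1) (xi t2 - xi s2) = 0.

Definition unitary (V : {linear H -> H}) : Prop :=
  (forall x y, inner (V x) (V y) = inner x y) /\ (forall y, exists x, V x = y).

Definition is_adjoint (V S : H -> H) : Prop :=
  forall x y, inner (V x) y = inner x (S y).

(* The adjoint is unique when it exists; id is a dummy default. *)
Definition adjoint (V : H -> H) : H -> H := xget (id : H -> H) [set S | is_adjoint V S].

Lemma unitary_adjointP (V : {linear H -> H}) :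
  unitary V -> is_adjoint V (adjoint V).
Proof.
move=> [Viso Vsurj]; rewrite /adjoint; case: xgetP => [S _ //|noS].
have [S VS] := choice Vsurj.
by case: (noS S) => x y; rewrite -{1}(VS y) Viso.
Qed.

Definition strongly_continuous (V : R -> {linear H -> H}) : Prop :=
  forall f : H, continuous (fun t => V t f).

Definition unitary_group (U : R -> {linear H -> H}) : Prop :=
  [/\ forall t, unitary (U t),
      strongly_continuous U,
      forall f, U 0 f = f &
      forall s t f, U (s + t) f = U s (U t f)].

(* The set I(xi) of unitary groups translating the increments of xi. *)
Definition shift_groups (xi : R -> H) : set (R -> {linear H -> H}) :=
  [set U | unitary_group U /\
           forall s t : R, xi (t + s) = xi t + U t (xi s)].

Definition linear_span (A : set H) : set H :=
  [set f | exists n (a : 'I_n -> C) (v : 'I_n -> H),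
     (forall i, A (v i)) /\ f = \sum_(i < n) a i *: v i].

(* The space H^xi_[t: closed span of the increments after time t. *)
Definition future (xi : R -> H) (t : R) : set H :=
  closure (linear_span
    [set f | exists s r : R, [/\ t <= s, t <= r & f = xi s - xi r]]).

Definition markovian_cocycle (xi : R -> H) (U W : R -> {linear H -> H}) : Prop :=
  [/\ forall t, unitary (W t),
      strongly_continuous W,
      forall f, W 0 f = f,
      forall s t f, W (t + s) f = W t (U t (W s (adjoint (U t) f))) &
      forall t f, 0 < t -> future xi t f -> W t f = f].

End Processes.

(* Main.v *)
Require Import Defs.
From mathcomp Require Import all_boot all_order all_algebra.
From mathcomp Require Import complex.
From mathcomp Require Import all_classical all_reals all_analysis.

Import Order.TTheory GRing.Theory Num.Theory.
Import numFieldNormedType.Exports.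
Local Open Scope classical_set_scope.
Local Open Scope ring_scope.

(** Since [U_t^* U_t = 1], the cocycle equation says that [V_t := W_t U_t] is a
one-parameter group.  For [r <= 0] and every [t >= r], the Markov property gives
[V_(-r) xi'_t = xi_(t-r) - xi_(-r)]: for [t <= 0] the left-hand side is
[W_(t-r) U_(-r) xi_t], and [U_(-r) xi_t = xi_(t-r) - xi_(-r)] is an increment
of [xi] after time [t-r].  Hence on each half-line [t >= r] the curve [xi'] is
carried by an isometry to a translate of [xi], up to a constant, and so inherits
its continuity and the orthogonality of its increments. *)

Set Implicit Arguments.
Unset Strict Implicit.
Unset Printing Implicit Defensive.

Section Cocycles.
Context (d : measure_display) (T : measurableType d) (R : realType)
  (P : probability T R).
Local Notation H := (L2 P).
Implicit Types (xi : R -> H) (U W : R -> {linear H -> H}).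

Lemma inner_inj (x y : H) : (forall z, inner z x = inner z y) -> x = y.
Proof.
move=> xy; apply/eqP; rewrite -subr_eq0 -(dnorm_eq0 (@inner _ _ _ P)).
by rewrite linearBr/= xy subrr.
Qed.

(** Pairing with any [z]: (z, V^* V x) = (V z, V x) = (z, x). *)
Lemma unitary_adjointK (V : {linear H -> H}) :
  unitary V -> cancel V (adjoint V).
Proof.
move=> uV x; apply: inner_inj => z.
by rewrite -(unitary_adjointP uV) uV.1.
Qed.

Lemma increment_future xi (t r s : R) :
  t <= r -> t <= s -> future xi t (xi r - xi s).
Proof.
move=> tr ts; apply: subset_closure.
exists 1, (fun=> 1), (fun=> xi r - xi s); split; first by exists r, s.
by rewrite big_ord1 scale1r.
Qed.

Section Perturbation.
Context xi U W (xi_U : shift_groups xi U)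
  (W_cocycle : markovian_cocycle xi U W).

Let xi' := fun t : R => if t <= 0 then W t (xi t) else xi t.

Lemma cocycle_groupD (s t : R) (f : H) :
  W (t + s) (U (t + s) f) = W t (U t (W s (U s f))).
Proof.
have [[uU _ _ UD] _] := xi_U; have [_ _ _ WD _] := W_cocycle.
by rewrite WD UD unitary_adjointK.
Qed.

Lemma cocycle_increment (t r s : R) : 0 <= t -> t <= r -> t <= s ->
  W t (xi r - xi s) = xi r - xi s.
Proof.
have [_ _ W0 _ WM] := W_cocycle.
(* The Markov property covers only [0 < t]; at [t = 0] the operator is the identity. *)
rewrite le_eqVlt => /predU1P[<- _ _|t0 tr ts]; first exact: W0.
by apply: WM => //; exact: increment_future.
Qed.

Lemma cocycle_shift_perturbation (r t : R) : r <= 0 -> r <= t ->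
  W (- r) (U (- r) (xi' t)) = xi (t - r) - xi (- r).
Proof.
move=> r0 rt; have [[_ _ U0 UD] Uxi] := xi_U.
have Ut : U (- r) (xi t) = xi (t - r) - xi (- r).
  by rewrite (addrC t) Uxi addrC addKr.
rewrite /xi'; case: leP => [t0|t0].
(* This exhibits [W t (U t _)], which the group law merges with the outer pair at time [- r]. *)
- have -> : W t (xi t) = W t (U t (U (- t) (xi t))).
    by rewrite -UD subrr U0.
  rewrite -cocycle_groupD -UD addrK Ut.
  rewrite [- r + t]addrC cocycle_increment ?subr_ge0//; first by rewrite gerDr.
(* Now [- r] is the earlier of the two times, so [W (- r)] itself fixes the increment. *)
- by rewrite Ut cocycle_increment ?oppr_ge0// lerDr ltW.
Qed.

Lemma cocycle_group_isometry (t : R) (f g : H) :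
  inner (W t (U t f)) (W t (U t g)) = inner f g.
Proof.
have [[uU _ _ _] _] := xi_U; have [uW _ _ _ _] := W_cocycle.
by rewrite (uW t).1 (uU t).1.
Qed.

(** The constant [xi (- r)] cancels in each increment. *)
Lemma perturbation_inner (r s1 t1 s2 t2 : R) :
  r <= 0 -> r <= s1 -> r <= t1 -> r <= s2 -> r <= t2 ->
  inner (xi' t1 - xi' s1) (xi' t2 - xi' s2) =
  inner (xi (t1 - r) - xi (s1 - r)) (xi (t2 - r) - xi (s2 - r)).
Proof.
move=> r0 rs1 rt1 rs2 rt2.
rewrite -(cocycle_group_isometry (- r)) !linearB/=.
by rewrite !cocycle_shift_perturbation// !opprB !addrA !subrK.
Qed.

Lemma perturbation_process : process xi -> process xi'.
Proof.
move=> xi_cont t; apply/cvgrPdist_lt => e e0.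
(* Strictly below [t], so that the half-line after [r] contains a neighbourhood of [t]. *)
pose r := Num.min (t - 1) 0.
have r0 : r <= 0 by rewrite ge_min lexx orbT.
have rt : r < t by rewrite gt_min gtrBl ltr01.
have xi_shift : xi (x - r) @[x --> t] --> xi (t - r).
  apply: (@cvg_comp _ _ _ (fun x => x - r) xi _ (nbhs (t - r))).
    by apply: cvgB; [exact: cvg_id|exact: cvg_cst].
  exact: xi_cont.
move/cvgrPdist_lt: xi_shift => /(_ e e0) xi_near.
near=> x.
have rx : r <= x by apply: ltW; near: x; exact: lt_nbhsr.
rewrite -[`|_|]/(norm_L2 _) /norm_L2 (@perturbation_inner r)// ?(ltW rt)//.
by rewrite -[sqrtC _]/(`|xi (t - r) - xi (x - r)|); near: x.
Unshelve. all: by end_near.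
Qed.

Lemma perturbation_noncorrelated :
  noncorrelated_increments xi -> noncorrelated_increments xi'.
Proof.
move=> xi_nc s1 t1 s2 t2 st1 st2 dis.
(* One half-line containing all four endpoints. *)
pose r := Num.min (Num.min s1 s2) 0.
have r0 : r <= 0 by rewrite ge_min lexx orbT.
have rs1 : r <= s1 by rewrite !ge_min lexx.
have rs2 : r <= s2 by rewrite !ge_min lexx orbT.
rewrite (@perturbation_inner r)// ?(le_trans rs1 st1) ?(le_trans rs2 st2)//.
apply: xi_nc; rewrite ?lerD2r//.
(* A common point [x] of the translated intervals gives the common point [x + r] of the original
   ones. *)
rewrite -subset0 => x /=; rewrite !in_itv/= !ltrBDr => xI.
by rewrite -[False]/(set0 (x + r)) -dis /= !in_itv.
Qed.

End Perturbation.
End Cocycles.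

Theorem proposition2p1 (d : measure_display) (T : measurableType d)
    (R : realType) (P : probability T R)
    (xi : R -> L2 P) (U W : R -> {linear L2 P -> L2 P})
    (xi_process : process xi)
    (xi_stationary : stationary_increments xi)
    (xi_noncorrelated : noncorrelated_increments xi)
    (xi0 : xi 0 = 0)
    (xi_U : shift_groups xi U)
    (W_cocycle : markovian_cocycle xi U W) :
  let xi' := fun t : R => if t <= 0 then W t (xi t) else xi t in
  process xi' /\ noncorrelated_increments xi'.
Proof.
split; first exact: (perturbation_process xi_U W_cocycle).
exact: (perturbation_noncorrelated xi_U W_cocycle).
Qed.
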